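(* Let $E$ be a Banach space and let $E^\ast$ be its dual. Assume that at least one of the following holds: (i) $C$ is a closed convex subset of $E$ and $C$ has FPP; (ii) $C$ is a closed convex subset of $E$, $C$ is locally weakly compact, and $C$ has WFPP; (iii) $C$ is a weakly$^\ast$ closed convex subset of $E^\ast$ and $C$ has W$^\ast$FPP (with respect to $E$). Let $T$ be a nonexpansive mapping on $C$. Suppose that $C$ is unbounded and that $T$ is asymptotically contractive. Then $T$ has a fixed point, i.e. there exists $z \in C$ with $Tz = z$.
   Context: A nonexpansive mapping on a subset $C$ of a Banach space is a mapping $T : C \to C$ with $\|Tx - Ty\| \le \|x-y\|$ for all $x,y \in C$ (norm of the ambient space; in case (iii) this is the dual norm of $E^\ast$). For unbounded $C$, $T$ is called asymptotically contractive if there exists $x_0 \in C$ such that $\limsup_{y \in C,\ \|y\| \to \infty} \frac{\|Tx_0 - Ty\|}{\|x_0 - y\|} < 1$. A closed convex subset $C$ of a Banach space has FPP (the fixed point property for nonexpansive mappings) if for every nonempty bounded closed convex subset $D$ of $C$, every nonexpansive mapping on $D$ has a fixed point. It has WFPP (the weak fixed point property) if for every nonempty weakly compact convex subset $D$ of $C$, every nonexpansive mapping on $D$ has a fixed point. A closed convex subset $C$ of the dual $E^\ast$ has W$^\ast$FPP (with respect to $E$) if for every nonempty weakly$^\ast$ compact convex subset $D$ of $C$, every nonexpansive mapping on $D$ has a fixed point. A closed convex subset $C$ of a Banach space is locally weakly compact if every bounded closed convex subset of $C$ is weakly compact. *)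

(* Defs.v *)
From HB Require Import structures.
From mathcomp Require Import all_boot all_order all_algebra.
From mathcomp Require Import all_classical all_reals.
From mathcomp Require Import ereal topology normedtype convex.

Set Implicit Arguments.
Unset Strict Implicit.
Unset Printing Implicit Defensive.

Import Order.TTheory GRing.Theory Num.Theory.
Import numFieldNormedType.Exports.

Local Open Scope classical_set_scope.
Local Open Scope ring_scope.

(* Banach spaces are real. *)

Section DualSpace.
Variables (R : realType) (E : normedModType R).

Definition continuous_functional : {pred (E -> R^o)} :=
  fun f => `[< linear f /\ continuous f >].

Record dual := Dual {
  dual_fun :> E -> R^o ;
  dual_funP : dual_fun \in continuous_functional }.

HB.instance Definition _ := [isSub for dual_fun].
HB.instance Definition _ := gen_eqMixin dual.
HB.instance Definition _ := gen_choiceMixin dual.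

Lemma continuous_functional_submod_closed :
  submod_closed continuous_functional.
Proof.
split.
  rewrite unfold_in; apply/asboolP.
  split; last by move=> x; exact: cst_continuous.
  by move=> a x y /=; rewrite scaler0 addr0.
move=> a f g; rewrite !unfold_in.
move=> /asboolP[lf cf] /asboolP[lg cg]; apply/asboolP; split.
  move=> b x y; rewrite !fctE /= lf lg !scalerDr !scalerA (mulrC a b).
  by rewrite addrACA.
move=> x; apply: (@continuousD _ _ _ (a \*: f) g x); last exact: cg.
exact: (continuousZl_tmp (cf x)).
Qed.

HB.instance Definition _ :=
  GRing.isSubmodClosed.Build R (E -> R^o) continuous_functional
    continuous_functional_submod_closed.
HB.instance Definition _ := [SubChoice_isSubLmodule of dual by <:].

Definition dual_norm (f : dual) : R :=
  sup [set `|f x| | x in [set x : E | `|x| <= 1]].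

Lemma dual_linear (f : dual) : linear f.
Proof. by have := dual_funP f; rewrite unfold_in => /asboolP[]. Qed.

Lemma dual_continuous (f : dual) : continuous f.
Proof. by have := dual_funP f; rewrite unfold_in => /asboolP[]. Qed.

HB.instance Definition _ (f : dual) :=
  GRing.isLinear.Build R E R^o *:%R f (@dual_linear f).

Lemma dual_norm_has_sup (f : dual) :
  has_sup [set `|f x| | x in [set x : E | `|x| <= 1]].
Proof.
split; first by exists `|f 0|, 0 => //=; rewrite normr0.
have /linear_boundedP[M [_ fM]] : bounded_near f (nbhs (0 : E)).
  by apply: (@continuous_linear_bounded _ _ _ 0 f); exact: dual_continuous.
exists (`|M| + 1) => _ [x /= x1 <-].
apply: le_trans (fM (`|M| + 1) _ x) _.
  by rewrite (le_lt_trans (ler_norm M))// ltrDl.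
by rewrite ler_piMr// addr_ge0.
Qed.

Lemma dual_norm_le (f : dual) x : `|f x| <= dual_norm f * `|x|.
Proof.
have [->|x0] := eqVneq x 0; first by rewrite linear0 !normr0 mulr0.
have x_gt0 : 0 < `|x| by rewrite normr_gt0.
rewrite -ler_pdivrMr//.
apply: (sup_upper_bound (dual_norm_has_sup f)); exists (`|x|^-1 *: x) => /=.
  by rewrite normrZ normfV normr_id mulVf// gt_eqF.
by rewrite linearZ normrZ normfV normr_id mulrC.
Qed.

Lemma dual_norm_lub (f : dual) k :
  (forall x, `|x| <= 1 -> `|f x| <= k) -> dual_norm f <= k.
Proof.
move=> fk; apply: ge_sup; first by case: (dual_norm_has_sup f).
by move=> _ [x /= x1 <-]; exact: fk.
Qed.

Lemma dual_norm_ge0 f : 0 <= dual_norm f.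
Proof.
apply: le_trans (normr_ge0 (f 0)) _.
by apply: (sup_upper_bound (dual_norm_has_sup f)); exists 0; rewrite //= normr0.
Qed.

Lemma dual_norm_leP (f : dual) x : `|x| <= 1 -> `|f x| <= dual_norm f.
Proof.
by move=> x1; rewrite (le_trans (dual_norm_le f x))// ler_piMr// dual_norm_ge0.
Qed.

Lemma ler_dual_normD f g : dual_norm (f + g) <= dual_norm f + dual_norm g.
Proof.
apply: dual_norm_lub => x x1; apply: le_trans (ler_normD (f x) (g x)) _.
by rewrite lerD// dual_norm_leP.
Qed.

Lemma dual_normZ (a : R) f : dual_norm (a *: f) = `|a| * dual_norm f.
Proof.
have le_Z b g : dual_norm (b *: g) <= `|b| * dual_norm g.
  apply: dual_norm_lub => x x1.
  by rewrite [leLHS](normrM b (g x)) ler_wpM2l// dual_norm_leP.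
apply/eqP; rewrite eq_le le_Z /=.
have [->|a0] := eqVneq a 0; first by rewrite normr0 mul0r dual_norm_ge0.
rewrite -[f in leLHS]scale1r -(mulVf a0) -scalerA.
rewrite (le_trans (ler_wpM2l _ (le_Z _ _)))//.
by rewrite mulrA normfV divff ?normr_eq0// mul1r.
Qed.

Lemma dual_norm0_eq0 f : dual_norm f = 0 -> f = 0.
Proof.
move=> f0; apply: val_inj; apply/funext => x.
apply/eqP; rewrite -normr_le0.
by rewrite (le_trans (dual_norm_le f x))// f0 mul0r.
Qed.

HB.instance Definition _ := @Lmodule_isNormed.Build R dual dual_norm
  ler_dual_normD dual_normZ dual_norm0_eq0.

Definition weak_topology : topologicalType :=
  sup_topology (fun f : dual => Topological.class (initial_topology f)).

Definition weak_star_topology : topologicalType :=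
  sup_topology (fun x : E =>
    Topological.class (initial_topology (fun f : dual => f x))).

End DualSpace.

Definition weakly_compact (R : realType) (E : normedModType R) (D : set E) :=
  @compact (weak_topology E) D.

Definition weak_star_compact (R : realType) (E : normedModType R)
    (D : set (dual E)) :=
  @compact (weak_star_topology E) D.

Definition weak_star_closed (R : realType) (E : normedModType R)
    (D : set (dual E)) :=
  @closed (weak_star_topology E) D.

Section FixedPointProperties.
Variables (R : realType) (X : normedModType R).

(* A mapping C -> C is a total function on X that sends C to C; its values
   outside C are irrelevant. *)
Definition nonexpansive (C : set X) (T : X -> X) :=
  {homo T : x / C x} /\
  (forall x y, C x -> C y -> `|T x - T y| <= `|x - y|).

Definition has_fixed_point (C : set X) (T : X -> X) := exists2 z, C z & T z = z.

Definition all_nonexpansive_fixed (D : set X) :=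
  forall T, nonexpansive D T -> has_fixed_point D T.

Definition norm_pinfty_within (C : set X) : set_system X :=
  filter_from [set: R] (fun M => [set y | C y /\ M < `|y|]).

(* At y = x0 the quotient is 0 by the convention for division; this does not
   affect the limsup as the norm of y tends to infinity. *)
Definition asymptotically_contractive (C : set X) (T : X -> X) :=
  exists2 x0, C x0 &
    (limf_esup (fun y => (`|T x0 - T y| / `|x0 - y|)%:E)
       (norm_pinfty_within C) < 1)%E.

(* In the fixed point properties below, closedness and convexity of C are not
   part of the predicate: they are assumed separately where it is used. *)
Definition FPP (C : set X) :=
  forall D : set X, D `<=` C -> D !=set0 -> bounded_set D -> closed D ->
    convex_set D -> all_nonexpansive_fixed D.

Definition WFPP (C : set X) :=
  forall D : set X, D `<=` C -> D !=set0 -> weakly_compact D ->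
    convex_set D -> all_nonexpansive_fixed D.

Definition locally_weakly_compact (C : set X) :=
  forall D : set X, D `<=` C -> bounded_set D -> closed D -> convex_set D ->
    weakly_compact D.

End FixedPointProperties.

Definition weak_star_FPP (R : realType) (E : normedModType R)
    (C : set (dual E)) :=
  forall D : set (dual E), D `<=` C -> D !=set0 -> weak_star_compact D ->
    convex_set D -> all_nonexpansive_fixed D.

(* Main.v *)
Require Import Defs.
From HB Require Import structures.
From mathcomp Require Import all_boot all_order all_algebra.
From mathcomp Require Import all_classical all_reals.
From mathcomp Require Import ereal topology normedtype convex.

(** An asymptotically contractive nonexpansive map [T] leaves a large ball
    around the base point [x0] invariant.  Far away, say for [M < |y|], one has
    [|T x0 - T y| <= c * |x0 - y|] with [c < 1], so on the ball of radius [r]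
    the distance from [x0] to [T y] is at most [|x0 - T x0| + c * r], which is
    at most [r] as soon as [r >= |x0 - T x0| / (1 - c)].  The remaining points
    satisfy [|y| <= M], and nonexpansiveness keeps [T y] within a fixed distance
    of [x0], so that enlarging [r] takes care of them
    ([asymptotically_contractive_invariant_ball]).

    The theorem then follows by applying the relevant fixed point property to
    the intersection [D] of [C] with such a ball: [D] is nonempty, bounded,
    closed and convex, hence weakly compact when [C] is locally weakly compact.
    In the dual space, [D] has to be weakly-star compact; it
    is the intersection of the weakly-star closed set [C] with a dual ball, and
    dual balls are weakly-star compact by the Banach-Alaoglu theorem
    ([weak_star_compact_closed_ball_]). *)

Set Implicit Arguments.
Unset Strict Implicit.
Unset Printing Implicit Defensive.

Import Order.TTheory GRing.Theory Num.Theory.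
Import numFieldNormedType.Exports.
Local Open Scope classical_set_scope.
Local Open Scope ring_scope.

Lemma convex_closed_ball_ (R : realType) (X : normedModType R) (x : X) (r : R) :
  convex_set (closed_ball_ Num.norm x r : set X).
Proof.
move=> y z t; rewrite !inE /closed_ball_ /= => xy xz.
have -> : x - conv t y z = t%:num *: (x - y) + (1 - t%:num) *: (x - z).
  by rewrite !scalerBr addrACA -scalerDl (addrC t%:num) subrK scale1r -opprD.
rewrite (le_trans (ler_normD _ _))// !normrZ !ger0_norm ?subr_ge0//.
rewrite (le_trans (lerD (ler_wpM2l _ xy) (ler_wpM2l _ xz))) ?subr_ge0//.
by rewrite -mulrDl addrC subrK mul1r.
Qed.

Lemma convex_setI (R : numDomainType) (M : lmodType R) (A B : set M) :
  convex_set A -> convex_set B -> convex_set (A `&` B).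
Proof.
move=> cA cB x y t /set_mem[Ax Bx] /set_mem[Ay By].
by apply/mem_set; split; apply/set_mem; [apply: cA|apply: cB]; exact/mem_set.
Qed.

Lemma bounded_closed_ball_ (R : realType) (X : normedModType R) (x : X) (r : R) :
  bounded_set (closed_ball_ Num.norm x r).
Proof.
rewrite /= /bounded_near; near=> M => y /= xy.
apply: (@le_trans _ _ (`|x| + r)); last first.
  by near: M; apply: nbhs_pinfty_ge; exact: num_real.
rewrite -[y](subKr x) (le_trans (ler_normB _ _))//.
by rewrite lerD2l.
Unshelve. all: by end_near. Qed.

Section InvariantBall.
Variables (R : realType) (X : normedModType R).

(** A limsup below 1 means that the supremum over some tail is already below 1,
    and any [c] between them will do.  The division in the limsup is harmless: where [x0 = y] both sides of the
    multiplied-out inequality vanish. *)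
Lemma asymptotically_contractiveP (C : set X) (T : X -> X) :
  asymptotically_contractive C T ->
  exists x0 c M, [/\ C x0, 0 <= c < 1 &
    forall y, C y -> M < `|y| -> `|T x0 - T y| <= c * `|x0 - y|].
Proof.
case=> x0 Cx0 /ereal_inf_lt[_ [V [M _ MV] <-]] supV.
have [c /andP[c0 c1] supc] : exists2 c : R, 0 <= c < 1 &
    (ereal_sup [set (`|T x0 - T y| / `|x0 - y|)%:E | y in V] <= c%:E)%E.
  move: supV; case: ereal_sup => [s| |]//.
  - rewrite lte_fin => s1; exists (Num.max s 0).
      by rewrite le_max lexx orbT gt_max s1 ltr01.
    by rewrite lee_fin le_max lexx.
  - by move=> _; exists 0; rewrite ?lexx ?ltr01 ?leNye.
exists x0, c, M; split; rewrite ?c0// => y Cy My.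
have [->|xy] := eqVneq x0 y; first by rewrite !subrr normr0 mulr0.
rewrite -ler_pdivrMr ?normr_gt0 ?subr_eq0// -lee_fin (le_trans _ supc)//.
by apply: ereal_sup_ubound; exists y => //; exact: MV.
Qed.

(** The radius is the sum of the bound needed for the points of norm at most
    [M] and of the one needed for the points of larger norm. *)
Lemma asymptotically_contractive_invariant_ball (C : set X) (T : X -> X) :
  nonexpansive C T -> asymptotically_contractive C T ->
  exists x0 r, [/\ C x0, 0 <= r &
    forall y, C y -> `|x0 - y| <= r -> `|x0 - T y| <= r].
Proof.
move=> [_ Tne] /asymptotically_contractiveP[x0 [c [M [Cx0 /andP[c0 c1] far]]]].
have c1' : 0 < 1 - c by rewrite subr_gt0.
pose d := `|x0 - T x0|; pose near_bound := d + (`|x0| + `|M|).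
have near_ge0 : 0 <= near_bound by rewrite !addr_ge0 ?normr_ge0.
have far_ge0 : 0 <= d / (1 - c) by rewrite divr_ge0 ?normr_ge0 ?ltW.
exists x0, (near_bound + d / (1 - c)); split=> [//||y Cy xyr].
  exact: addr_ge0.
have xTy k : `|T x0 - T y| <= k -> `|x0 - T y| <= d + k.
  by move=> Tk; rewrite (le_trans (ler_distD (T x0) _ _))// lerD2l.
have [yM|My] := leP `|y| M.
  rewrite (le_trans (xTy (`|x0| + `|M|) _)) ?lerDl//.
  rewrite (le_trans (Tne _ _ Cx0 Cy))// (le_trans (ler_normB _ _))// lerD2l.
  by rewrite (le_trans yM)// ler_norm.
apply: le_trans (xTy _ (le_trans (far _ Cy My) (ler_wpM2l c0 xyr))) _.
(* [d / (1 - c)] is the fixed point of [k |-> d + c * k], which therefore maps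
   every larger [k] below itself. *)
have {1}-> : d = (1 - c) * (d / (1 - c)) by rewrite mulrC divfK// gt_eqF.
rewrite mulrDr addrCA -mulrDl subrK mul1r lerD2r.
by rewrite ler_piMl// ltW.
Qed.

(** Only the pieces of [C] cut out by balls matter, so the fixed point property
    of these pieces is all that each of the three cases has to provide. *)
Lemma asymptotically_contractive_fixed_point (C : set X) (T : X -> X) :
  nonexpansive C T -> asymptotically_contractive C T ->
  (forall x0 r, C x0 -> 0 <= r ->
    all_nonexpansive_fixed (C `&` closed_ball_ Num.norm x0 r)) ->
  has_fixed_point C T.
Proof.
move=> Tne /(asymptotically_contractive_invariant_ball Tne).
case: Tne => TC Tne [x0 [r [Cx0 r0 Tball]]] fixD.
have [|z [Cz _] Tz] := fixD x0 r Cx0 r0 T; last by exists z.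
split=> [y [Cy yr]|y z [Cy _] [Cz _]]; last exact: Tne.
by split; [exact: TC|exact: Tball].
Qed.

End InvariantBall.

Section BanachAlaoglu.
Variables (R : realType) (E : normedModType R).

Lemma cvg_weak_star (F : set_system (dual E)) (l : dual E) : Filter F ->
  (forall x : E, (fun f : dual E => f x) @ F --> l x) ->
  F --> (l : weak_star_topology E).
Proof.
move=> FF Fl; apply/cvg_sup => x A.
rewrite /= (@nbhsE (initial_topology (fun f : dual E => f x))).
move=> -[_ [[B Bo <-] Bl] BA].
apply: (@filterS _ F _ _ _ BA); apply: (Fl x).
exact: open_nbhs_nbhs.
Qed.

(** The image of an ultrafilter under a map is again maximal among proper
    filters, so a cluster point of the image is already a limit. *)
Lemma ultra_fmap_cvg (S : Type) (V : topologicalType) (u : S -> V)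
    (F : set_system S) (K : set V) :
  UltraFilter F -> compact K -> (\forall s \near F, K (u s)) ->
  exists2 l, K l & u @ F --> l.
Proof.
move=> FU Kco FK; have [l [Kl Fl]] := Kco (u @ F) _ FK.
exists l => // A Al.
have [//|FnA] := in_ultra_setVsetC (u @^-1` A) FU.
by have [v [? ?]] := Fl (~` A) A FnA Al.
Qed.

Lemma bounded_linear_dual (l : E -> R^o) (k : R) :
  linear l -> (forall x, `|l x| <= k * `|x|) -> exists f : dual E, f =1 l.
Proof.
move=> llin lk.
pose L := HB.pack_for {linear E -> R^o} l
  (GRing.isLinear.Build R E R^o *:%R l llin).
suff lC : l \in @continuous_functional R E by exists (Dual lC).
rewrite unfold_in; apply/asboolP; split=> //.
apply: (@bounded_linear_continuous R E R^o L); apply/linear_boundedP.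
near=> r => x; rewrite (le_trans (lk x))// ler_wpM2r//.
by near: r; exact: nbhs_pinfty_ge (num_real k).
Unshelve. all: by end_near. Qed.

(** The Banach-Alaoglu theorem: along an ultrafilter on the dual ball, the
    values at each point of [E] stay in a compact interval and hence converge;
    the pointwise limit inherits linearity and the norm bound, so it is a point
    of the ball. *)
Theorem weak_star_compact_closed_ball_ (f0 : dual E) (r : R) : 0 <= r ->
  weak_star_compact (closed_ball_ Num.norm f0 r).
Proof.
move=> r0; rewrite /weak_star_compact compact_ultra => F FU FB.
have /choice[l Fl] : forall x : E, exists l : R^o,
    `|f0 x - l| <= r * `|x| /\ (fun f : dual E => f x) @ F --> l.
  move=> x.
  have [|l lK Fl] := @ultra_fmap_cvg _ R^o (fun f : dual E => f x) F
    `[f0 x - r * `|x|, f0 x + r * `|x|] FU (@segment_compact _ _ _).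
    apply: filterS FB => f fB /=.
    rewrite in_itv/= -ler_distlC.
    rewrite (le_trans (dual_norm_le (f0 - f) x))// ler_wpM2r//.
  exists l; split=> //.
  by move: lK; rewrite /= in_itv/= -ler_distlC.
have llin : linear l.
  move=> a x y.
  have Flxy : (fun f : dual E => f (a *: x + y)) @ F --> a *: l x + l y.
    under eq_fun do rewrite linearP.
    apply: cvgD; last exact: (Fl y).2.
    by apply: cvgZr; exact: (Fl x).2.
  exact: cvg_unique (Fl _).2 Flxy.
have [x|f fl] := @bounded_linear_dual l (dual_norm f0 + r) llin.
  rewrite -[l x](subKr (f0 x)) (le_trans (ler_normB _ _))// mulrDl.
  by rewrite lerD ?dual_norm_le//; exact: (Fl x).1.
exists f; split.
  apply: dual_norm_lub => x x1.
  rewrite [X in `|X|](_ : _ = f0 x - l x); last by rewrite -fl.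
  by rewrite (le_trans (Fl x).1)// ler_piMr.
by apply: cvg_weak_star => x; rewrite fl; exact: (Fl x).2.
Qed.

End BanachAlaoglu.

Theorem theorem1 (R : realType) (E : completeNormedModType R) :
  (forall (C : set E) (T : E -> E),
     [/\ closed C, convex_set C & FPP C] \/
     [/\ closed C, convex_set C, locally_weakly_compact C & WFPP C] ->
     nonexpansive C T ->
     ~ bounded_set C ->
     asymptotically_contractive C T ->
     exists2 z, C z & T z = z)
  /\
  (forall (C : set (dual E)) (T : dual E -> dual E),
     [/\ weak_star_closed C, convex_set C & weak_star_FPP C] ->
     nonexpansive C T ->
     ~ bounded_set C ->
     asymptotically_contractive C T ->
     exists2 z, C z & T z = z).
Proof.
split=> C T hC Tne _ Tac;
    apply: (asymptotically_contractive_fixed_point Tne Tac) => x0 r Cx0 r0.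
  have DC : C `&` closed_ball_ Num.norm x0 r `<=` C by move=> y [].
  have D0 : C `&` closed_ball_ Num.norm x0 r !=set0.
    by exists x0; split; rewrite //= /closed_ball_/= subrr normr0.
  have Db : bounded_set (C `&` closed_ball_ Num.norm x0 r).
    by apply: sub_boundedr (bounded_closed_ball_ x0 r) => A rA y [_ /rA].
  have Dcl : closed C -> closed (C `&` closed_ball_ Num.norm x0 r).
    by move=> ?; apply: closedI => //; exact: closed_closed_ball_.
  have Dcv : convex_set C -> convex_set (C `&` closed_ball_ Num.norm x0 r).
    by move=> ?; apply: convex_setI => //; exact: convex_closed_ball_.
  case: hC => [[Ccl Ccv CF]|[Ccl Ccv Clw CW]].
    by apply: CF => //; [exact: Dcl|exact: Dcv].
  apply: CW => //; last exact: Dcv.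
  by apply: Clw => //; [exact: Dcl|exact: Dcv].
case: hC => Ccl Ccv CW; apply: CW => [y []//|||].
- by exists x0; split; rewrite //= /closed_ball_/= subrr normr0.
- rewrite setIC; apply: compact_closedI Ccl.
  exact: weak_star_compact_closed_ball_.
- by apply: convex_setI => //; exact: convex_closed_ball_.
Qed.
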